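(* Let $G$ be a graph without isolated vertices, and let $G_1,G_2,\dots,G_{\omega}$ be all the connected components of $G$. Then \[ \max_{1\leq i\leq \omega}\chi_d^t(G_i)+2\omega-2\ \leq\ \chi_d^t(G)\ \leq\ \sum_{i=1}^{\omega}\chi_d^t(G_i). \]
   Context: All graphs are finite, simple and undirected. A total dominator coloring of a graph $G$ is a proper vertex coloring of $G$ in which each vertex of $G$ is adjacent to every vertex of some color class (a color class is the set of all vertices receiving a given color). The total dominator chromatic number $\chi_d^t(G)$ is the minimum number of color classes in a total dominator coloring of $G$. *)

(* Defs.v *)
From mathcomp Require Import all_boot.

Set Implicit Arguments.
Unset Strict Implicit.
Unset Printing Implicit Defensive.

Record sgraph := SGraph {
  vertex :> finType;
  edge : rel vertex;
  edge_sym : symmetric edge;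
  edge_irrefl : irreflexive edge
}.

Definition no_isolated (G : sgraph) : Prop :=
  forall x : G, exists y : G, edge x y.

Section Induced.
Variables (G : sgraph) (S : {set G}).

Definition induced_edge : rel {x : G | x \in S} :=
  fun x y => edge (val x) (val y).

Fact induced_edge_sym : symmetric induced_edge.
Proof. by move=> x y; rewrite /induced_edge edge_sym. Qed.

Fact induced_edge_irrefl : irreflexive induced_edge.
Proof. by move=> x; rewrite /induced_edge edge_irrefl. Qed.

Definition induced : sgraph := SGraph induced_edge_sym induced_edge_irrefl.
End Induced.

(* The vertex sets of the connected components; the component itself is the
   subgraph induced on such a set. *)
Definition components (G : sgraph) : {set {set G}} :=
  equivalence_partition (connect (@edge G)) [set: G].

Section Coloring.
Variables (G : sgraph) (C : eqType) (f : G -> C).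

Definition proper_coloring : bool :=
  [forall x, forall y, edge x y ==> (f x != f y)].

(* Only colors that are actually used give a class: an empty class would be
   vacuously dominated by every vertex. *)
Definition color_classes : {set {set G}} :=
  [set [set y | f y == f x] | x : G].

Definition total_dominator_coloring : bool :=
  proper_coloring &&
  [forall x, exists D in color_classes, forall y in D, edge x y].
End Coloring.

(* A coloring has at most #|G| classes, so the vertices of G suffice as colors
   (tdchrom_min below covers arbitrary colors). The default value #|G| is
   irrelevant for a graph without isolated vertices, whose injective colorings
   are total dominator colorings with #|G| classes (tdchrom_attained below);
   a graph with an isolated vertex has no total dominator coloring. *)
Definition tdchrom (G : sgraph) : nat :=
  \big[minn/#|G|]_(f : {ffun G -> G} | total_dominator_coloring f)
     #|color_classes f|.

Lemma tdchrom_min (G : sgraph) (C : eqType) (f : G -> C) :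
  total_dominator_coloring f -> tdchrom G <= #|color_classes f|.
Proof.
move=> tdf.
have ex x : exists y, f y == f x by exists x.
pose g : {ffun G -> G} := [ffun x => xchoose (ex x)].
have gE x y : (g x == g y) = (f x == f y).
  rewrite !ffunE; apply/eqP/eqP => [gxy|fxy].
    by rewrite -(eqP (xchooseP (ex x))) gxy (eqP (xchooseP (ex y))).
  by apply: eq_xchoose => z; rewrite fxy.
have clE : color_classes g = color_classes f.
  by apply: eq_imset => x; apply/setP => y; rewrite !inE gE.
have tdg : total_dominator_coloring g.
  move: tdf; rewrite /total_dominator_coloring clE => /andP[/forallP pf ->].
  rewrite andbT; apply/forallP => x; apply/forallP => y.
  by rewrite gE; exact: (forallP (pf x) y).
rewrite -clE /tdchrom; have := mem_index_enum g.
elim: (index_enum _) => // h r IHr; rewrite inE big_cons.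
case/predU1P => [<-|/IHr le_r]; first by rewrite tdg geq_minl.
by case: ifP => // _; exact: leq_trans (geq_minr _ _) le_r.
Qed.

Lemma tdchrom_attained (G : sgraph) : no_isolated G ->
  exists2 f : {ffun G -> G}, total_dominator_coloring f &
    #|color_classes f| = tdchrom G.
Proof.
move=> noiso; rewrite /tdchrom.
elim/big_ind: _ => [|m n [f tdf <-] [g tdg <-]|f tdf]; last by exists f.
  pose h : {ffun G -> G} := [ffun x => x].
  have hE x : [set y | h y == h x] = [set x].
    by apply/setP => y; rewrite !inE !ffunE.
  exists h.
    apply/andP; split; apply/forallP => x.
      apply/forallP => y; apply/implyP => exy; rewrite !ffunE.
      by apply/eqP => xy; rewrite xy edge_irrefl in exy.
    have [y exy] := noiso x; apply/existsP; exists [set y].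
    apply/andP; split; first by apply/imsetP; exists y; rewrite ?hE.
    by apply/forallP => z; apply/implyP; rewrite inE => /eqP ->.
  by rewrite card_imset // => x y; rewrite !hE => /set1_inj.
by case: (leqP #|color_classes f| #|color_classes g|) => _;
  [exists f | exists g].
Qed.

(* Main.v *)
Require Import Defs.
From mathcomp Require Import all_boot.

(** Lower bound: a color class dominated by a vertex [x] is a nonempty subset of
    the neighborhood of [x], hence lies in the component of [x]. So an optimal
    coloring of [G] restricts to a total dominator coloring of any component [S],
    whose classes are the traces on [S] of the classes meeting [S]. Any other
    component [T] contains two classes missing [S]: one dominated by some [x] in
    [T], and one dominated by a vertex of that first class.
    Upper bound: color the components optimally with disjoint sets of colors. *)

Set Implicit Arguments.
Unset Strict Implicit.
Unset Printing Implicit Defensive.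

Section Components.
Variable G : sgraph.
Implicit Types (S T : {set G}) (x y : G).

Lemma components_partition : partition (components G) [set: G].
Proof.
apply/equivalence_partitionP => x y z _ _ _; split; first exact: connect0.
by move=> cxy; exact: (same_connect (sym_connect_sym (@edge_sym G)) cxy).
Qed.

Lemma components_trivIset : trivIset (components G).
Proof. by case/and3P: components_partition. Qed.

Lemma component_edge S x y :
  S \in components G -> edge x y -> (x \in S) = (y \in S).
Proof.
case/imsetP => z _ -> exy; rewrite !inE /=.
by rewrite (same_connect_r (sym_connect_sym (@edge_sym G)) (connect1 exy)).
Qed.

Lemma component_neq0 S : S \in components G -> exists x, x \in S.
Proof.
case/and3P: components_partition => _ _ P0 PS; apply/set0Pn.
by apply: contraNneq P0 => <-.
Qed.

Lemma component_pblock x : pblock (components G) x \in components G.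
Proof. by rewrite pblock_mem // (cover_partition components_partition) inE. Qed.

Lemma mem_component_pblock x : x \in pblock (components G) x.
Proof. by rewrite mem_pblock (cover_partition components_partition) inE. Qed.

Lemma component_eq S T x : S \in components G -> T \in components G ->
  x \in S -> x \in T -> S = T.
Proof.
move=> PS PT xS xT; rewrite -(def_pblock components_trivIset PS xS).
exact: def_pblock components_trivIset PT xT.
Qed.

Lemma induced_no_isolated S : no_isolated G -> S \in components G ->
  no_isolated (induced S).
Proof.
move=> noiso PS x; have [y exy] := noiso (val x).
have yS : y \in S by rewrite -(component_edge PS exy) (valP x).
by exists (Sub y yS).
Qed.

End Components.

Section Dominated.
Variables (G : sgraph) (C : eqType) (f : G -> C).
Hypothesis tdf : total_dominator_coloring f.

Lemma tdc_proper x y : edge x y -> f x != f y.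
Proof. by case/andP: tdf => /forallP/(_ x)/forallP/(_ y)/implyP. Qed.

(** The dominated class is given by a representative [z]; taking [y := z] shows that [x] is adjacent
    to [z], so [z] lies in the component of [x]. *)
Lemma tdc_dominates x : exists z, forall y, f y = f z -> edge x y.
Proof.
case/andP: tdf => _ /forallP/(_ x)/existsP[D /andP[/imsetP[z _ ->]]].
move=> /forallP dom; exists z => y fyz.
by apply: (implyP (dom y)); rewrite inE fyz.
Qed.

End Dominated.

Lemma tdcI (G : sgraph) (C : eqType) (f : G -> C) :
  (forall x y, edge x y -> f x != f y) ->
  (forall x, exists z, forall y, f y = f z -> edge x y) ->
  total_dominator_coloring f.
Proof.
move=> pf df; apply/andP; split; apply/forallP => x.
  by apply/forallP => y; apply/implyP/pf.
have [z dz] := df x; apply/existsP; exists [set y | f y == f z].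
rewrite imset_f //=; apply/forallP => y; apply/implyP.
by rewrite inE => /eqP/dz.
Qed.

Section LowerBound.
Variables (G : sgraph) (C : eqType) (f : G -> C).
Hypothesis tdf : total_dominator_coloring f.
Implicit Types S T : {set G}.

Let meeting S := [set D in color_classes f | ~~ [disjoint D & S]].

(** The representative of the class dominated by a vertex of [S] lies in [S], so the color of that
    class is still used after restriction. *)
Lemma tdc_restrict S : S \in components G ->
  total_dominator_coloring (fun x : induced S => f (val x)).
Proof.
move=> PS; apply: tdcI => [x y|x]; first exact: tdc_proper tdf _ _.
have [z dz] := tdc_dominates tdf (val x).
have zS : z \in S by rewrite -(component_edge PS (dz z erefl)) (valP x).
by exists (Sub z zS) => y; exact: dz.
Qed.

Lemma tdchrom_component_meeting S : S \in components G ->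
  tdchrom (induced S) <= #|meeting S|.
Proof.
move=> PS; apply: leq_trans (tdchrom_min (tdc_restrict PS)) _.
(* Every class of the restriction is the trace of a class meeting [S], so the classes of the
   restriction lie in the image of [meeting S] under [trace]. *)
pose trace (D : {set G}) : {set induced S} := [set y | val y \in D].
apply: leq_trans (leq_imset_card trace _).
apply/subset_leq_card/subsetP => _ /imsetP[x _ ->].
apply/imsetP; exists [set y | f y == f (val x)].
  rewrite inE imset_f //=; apply/pred0Pn; exists (val x) => /=.
  by rewrite inE eqxx (valP x).
by apply/setP => y; rewrite !inE.
Qed.

Lemma component_two_classes T : T \in components G ->
  1 < #|[set D in color_classes f | D \subset T]|.
Proof.
move=> PT; have [x xT] := component_neq0 PT.
have dom_sub u : u \in T -> exists2 z, z \in T &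
    exists D, [/\ D \in color_classes f, D \subset T, z \in D & u \notin D].
  move=> uT; have [z dz] := tdc_dominates tdf u.
  have nT y : f y = f z -> y \in T by move/dz/(component_edge PT) <-.
  exists z; [exact: nT | exists [set y | f y == f z]; split].
  - exact: imset_f.
  - by apply/subsetP => y; rewrite inE => /eqP/nT.
  - by rewrite inE.
  - by rewrite inE; apply/eqP => /dz; rewrite edge_irrefl.
(* [D] is dominated by [x] and contains [z]; [E] is dominated by [z] and so misses it, because no
   vertex is adjacent to itself. Hence [D] and [E] differ. *)
have [z zT [D [cD DT zD _]]] := dom_sub x xT.
have [_ _ [E [cE ET _ zE]]] := dom_sub z zT.
apply/card_gt1P; exists D, E; rewrite !inE cD cE; split=> //.
by apply: contraNneq zE => <-.
Qed.

Lemma card_color_classes_ge S : S \in components G ->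
  tdchrom (induced S) + (2 * #|components G| - 2) <= #|color_classes f|.
Proof.
move=> PS; set P := components G; set F := color_classes f.
have mF : meeting S \subset F by apply/subsetP => D; rewrite inE => /andP[].
rewrite -(cardsID (meeting S) F) (setIidPr mF).
apply: leq_add (tdchrom_component_meeting PS) _.
have -> : 2 * #|P| - 2 = \sum_(T in P :\ S) 2.
  by rewrite sum_nat_const (cardsD1 S P) PS mulnDr addKn mulnC.
have nonmeeting T D : T \in P :\ S -> D \in F -> D \subset T ->
    D \in F :\: meeting S.
  case/setD1P => TS PT cD DT; rewrite !inE cD andbT negbK.
  apply/pred0P => x /=; apply/andP => -[/(subsetP DT) xT xS].
  by case/eqP: TS; exact: component_eq xT xS.
(* Double counting of the pairs of a component [T] other than [S] and a class inside [T]: each [T]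
   occurs at least twice, and each class at most once, being nonempty while components are
   disjoint. *)
apply: (@leq_trans (\sum_(T in P :\ S) \sum_(D in F :\: meeting S | D \subset T) 1)).
  apply: leq_sum => T PT; rewrite sum1_card.
  case/setD1P: (PT) => _ /component_two_classes/leq_trans; apply.
  apply/subset_leq_card/subsetP => D; rewrite inE => /andP[cD DT].
  by rewrite unfold_in DT (nonmeeting T).
rewrite (exchange_big_dep (mem (F :\: meeting S))) /=; last by move=> T D _ /andP[].
rewrite -sum1_card; apply: leq_sum => D DF; rewrite sum1_card.
have /imsetP[x _ defD] : D \in F by case/setDP: DF.
have xD : x \in D by rewrite defD inE.
apply/card_le1_eqP => T U; rewrite !unfold_in.
case/andP => /setD1P[_ PT] /andP[_ /subsetP/(_ x xD) xT].
case/andP => /setD1P[_ PU] /andP[_ /subsetP/(_ x xD) xU].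
exact: component_eq xU xT.
Qed.

End LowerBound.

Section UpperBound.
Variable G : sgraph.
Variable f : forall S : {set G}, induced S -> induced S.
Hypothesis tdf : forall S, S \in components G -> total_dominator_coloring (@f S).

(** Recording the component in the color keeps the palettes of distinct components disjoint. Local
    colors are sent to [G] by [val] to get one color type for all [S]. The value [None] never
    occurs, since [x] lies in its own block. *)
Let glue (x : G) : {set G} * option G :=
  let S := pblock (components G) x in (S, omap (fun u => val (@f S u)) (insub x)).

Lemma glueE S (x : induced S) : S \in components G ->
  glue (val x) = (S, Some (val (f x))).
Proof.
move=> PS; rewrite /glue (def_pblock (components_trivIset G) PS (valP x)).
by rewrite valK.
Qed.

(** The first coordinate of the color forces [y] into [S], so a class of [glue] is the image of a
    class of a single [f S]. *)
Lemma glue_eq S (x : induced S) y : S \in components G ->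
  glue y = glue (val x) -> exists2 u : induced S, y = val u & f u = f x.
Proof.
move=> PS gyx; have yS : y \in S.
  have <- : pblock (components G) y = S.
    by rewrite -[LHS]/((glue y).1) gyx glueE.
  exact: mem_component_pblock.
exists (Sub y yS) => //; apply: val_inj; move: gyx.
by rewrite -[y]/(val (Sub y yS : induced S)) !glueE // => -[].
Qed.

Lemma in_component x : exists2 S, S \in components G &
  exists u : induced S, x = val u.
Proof.
exists (pblock (components G) x); first exact: component_pblock.
by exists (Sub x (mem_component_pblock x)).
Qed.

Lemma tdc_glue : total_dominator_coloring glue.
Proof.
apply: tdcI => [x y exy|x]; have [S PS [u defx]] := in_component x; subst x.
  apply/eqP => /esym/(glue_eq PS)[v defy fvu]; subst y.
  by have /eqP[] := tdc_proper (tdf PS) (exy : edge u v).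
have [z dz] := tdc_dominates (tdf PS) u; exists (val z) => y.
by case/(glue_eq PS) => v -> /dz.
Qed.

Lemma card_color_classes_glue :
  #|color_classes glue| <= \sum_(S in components G) #|color_classes (@f S)|.
Proof.
pose lift S := [set val @: (D : {set induced S}) | D in color_classes (@f S)].
apply: (@leq_trans #|\bigcup_(S in components G) lift S|).
  apply/subset_leq_card/subsetP => _ /imsetP[x _ ->].
  have [S PS [u ->]] := in_component x.
  apply/bigcupP; exists S => //; apply/imsetP.
  exists [set v | f v == f u]; first exact: imset_f.
  apply/setP => y; rewrite inE; apply/eqP/imsetP.
    by case/(glue_eq PS) => v -> fvu; exists v; rewrite // inE fvu.
  by case=> v; rewrite inE => /eqP fvu ->; rewrite !glueE // fvu.
elim/big_rec2: _ => [|S m B _ leBm]; first by rewrite cards0.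
apply: leq_trans (leq_card_setU _ _) (leq_add _ leBm); exact: leq_imset_card.
Qed.

End UpperBound.

Theorem theorem3p2 (G : sgraph) (hG : no_isolated G) :
  \max_(S in components G) tdchrom (induced S) + (2 * #|components G| - 2)
    <= tdchrom G
  /\ tdchrom G <= \sum_(S in components G) tdchrom (induced S).
Proof.
split.
  have [f tdf <-] := tdchrom_attained hG.
  (* Without components (the empty graph) the maximum is 0 and the truncated difference [0 - 2] is
     0. *)
  have [P0|[S0 PS0]] := set_0Vmem (components G).
    by rewrite P0 big_set0 cards0.
  have [|S PS ->] := @eq_bigmax_cond _ (mem (components G)) (fun S => tdchrom (induced S)).
    by apply/card_gt0P; exists S0.
  exact: card_color_classes_ge.
(* The condition on [S] stands under the existential so that a coloring can be chosen for all sets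
   at once; sets that are not components get the identity as a dummy. *)
have attained S : exists f : {ffun induced S -> induced S}, S \in components G ->
    total_dominator_coloring f /\ #|color_classes f| = tdchrom (induced S).
  have [PS|_] := boolP (S \in components G); last by exists [ffun x => x].
  by have [f] := tdchrom_attained (induced_no_isolated hG PS); exists f.
have [f fP] := fin_all_exists attained.
have tdf S : S \in components G -> total_dominator_coloring (f S) by case/fP.
apply: leq_trans (tdchrom_min (tdc_glue tdf)) _.
apply: leq_trans (card_color_classes_glue f) _.
by apply: leq_sum => S /fP[_ ->].
Qed.
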